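(* Let $K\subset\mathbf{R}$ be a compact set of infinite cardinality with $\mathrm{cap}(K)<1$. A continuous function $f:K\to\mathbf{R}$ is $\mathbf{Z}[T]$-approximable if and only if it is $J_0(K)$-interpolable.
   Context: For a continuous function $f$ on $K$, $|f|_K=\max_{x\in K}|f(x)|$. For $n\ge 1$, $T_n(K)$ denotes the unique monic real polynomial of degree $n$ that minimizes $|P|_K$ among all monic real polynomials $P$ of degree $n$. The capacity radius of $K$ is $$\mathrm{cap}(K)=\lim_{n\to\infty}|T_n(K)|_K^{1/n}=\lim_{n\to\infty}\ \sup_{x_1,\dots,x_n\in K}\ \prod_{1\leq i\neq j\leq n}|x_i-x_j|^{1/(n(n-1))},$$ the two limits existing and being equal. A function $f:K\to\mathbf{R}$ is $\mathbf{Z}[T]$-approximable if it is a uniform limit on $K$ of polynomials with integer coefficients. For a subset $X\subset K$, $f$ is $X$-interpolable if there exists $R\in\mathbf{Z}[T]$ such that $f=R$ on $X$. Let $B(K)=\{P\in\mathbf{Z}[T] : |P|_K<1\}$ and $J(K)=\{x\in K : P(x)=0 \text{ for all } P\in B(K)\}$. When $\mathrm{cap}(K)<1$, the set $B(K)$ contains a nonzero polynomial, so every element of $J(K)$ is an algebraic number. $J_0(K)$ is the set of $\alpha\in J(K)$ such that all conjugates of $\alpha$ (the complex roots of its minimal polynomial over $\mathbf{Q}$) are real and belong to $K$. *)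

(* Defs.v *)
From HB Require Import structures.
From mathcomp Require Import all_boot all_order all_algebra.
From mathcomp Require Import all_classical all_reals all_analysis.
From mathcomp Require Import complex.
Import Order.TTheory GRing.Theory Num.Theory.
Import numFieldNormedType.Exports.

Set Implicit Arguments.
Unset Strict Implicit.
Unset Printing Implicit Defensive.

Local Open Scope classical_set_scope.
Local Open Scope ring_scope.

(* Functions on K are total functions on R, of which only the values on K
   matter.  The supremum is a maximum when K is compact and nonempty and f is
   continuous on K. *)
Definition supnorm (R : realType) (K : set R) (f : R -> R) : R :=
  sup [set `|f x| | x in K].

Definition is_cheb_poly (R : realType) (K : set R) (n : nat) (T : {poly R}) :
    Prop :=
  [/\ T \is monic, size T = n.+1 &
      forall P : {poly R}, P \is monic -> size P = n.+1 ->
        supnorm K (horner T) <= supnorm K (horner P)].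

(* For K compact and infinite there is exactly one such polynomial; the default
   value 0 is then never used. *)
Definition cheb_poly (R : realType) (K : set R) (n : nat) : {poly R} :=
  xget 0 [set T | is_cheb_poly K n T].

(* The limit exists for every infinite compact K, and is then equal to the
   transfinite diameter of K. *)
Definition cap (R : realType) (K : set R) : R :=
  limn (fun n : nat => supnorm K (horner (cheb_poly K n)) `^ (n%:R^-1)).

Definition zeval (R : realType) (P : {poly int}) : R -> R :=
  horner (map_poly (intr : int -> R) P).

Definition Z_approximable (R : realType) (K : set R) (f : R -> R) : Prop :=
  exists P : nat -> {poly int},
    {uniform K, (fun n : nat => (zeval (P n) : R -> R)) @ \oo --> f}.

Definition Z_interpolable (R : realType) (X : set R) (f : R -> R) : Prop :=
  exists P : {poly int}, forall x : R, X x -> f x = zeval P x.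

Definition BZ (R : realType) (K : set R) : set {poly int} :=
  [set P | supnorm K (zeval P) < 1].

Definition J (R : realType) (K : set R) : set R :=
  [set x | K x /\ forall P : {poly int}, BZ K P -> zeval P x = 0].

(* The monic generator of the ideal of rational polynomials vanishing at a;
   no polynomial qualifies when a is transcendental. *)
Definition is_minpoly (R : realType) (a : R) (p : {poly rat}) : Prop :=
  p \is monic /\
  forall q : {poly rat}, root (map_poly (ratr : rat -> R) q) a = (p %| q).

Definition J0 (R : realType) (K : set R) : set R :=
  [set a | J K a /\
    exists2 p : {poly rat}, is_minpoly a p &
      forall z : R[i], root (map_poly (ratr : rat -> R[i]) p) z ->
        exists2 x : R, K x & z = x%:C%C].

(* Main.v *)
Require Import Defs.
From HB Require Import structures.
From mathcomp Require Import all_boot all_order all_algebra.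
From mathcomp Require Import all_classical all_reals all_analysis.
From mathcomp Require Import complex polyrcf ring lra zify.
Import Order.TTheory GRing.Theory Num.Theory.
Import numFieldNormedType.Exports.

Local Open Scope classical_set_scope.
Local Open Scope ring_scope.

Set Implicit Arguments.
Unset Strict Implicit.
Unset Printing Implicit Defensive.

(** Two integer polynomials that are both close to [f] differ by an element of
    [BZ K], which vanishes on [J K]; hence an approximable [f] agrees on [J
    K], and a fortiori on [J0 K], with one of its approximants.

    For the converse, [cap K < 1] is used once, to find a nonzero [P] in [BZ
    K] ([small_integer_poly]). Fekete's lemma turns the capacity into a
    geometric bound on the norms of the Chebyshev polynomials
    ([cap_lt1_geometric]); by subtracting fractions of them, all coefficients
    of degree at least [M] of a Chebyshev polynomial become integers at a
    small cost, and the pigeonhole principle, applied to the [M] remaining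
    coefficients, yields two such polynomials whose difference is nearly
    integral.

    Once [P] is known, a real polynomial is a combination of the powers of [P]
    with coefficients of degree less than that of [P]. Rounding these
    coefficients changes it by a bounded amount, since the powers of [P]
    decrease geometrically on [K] ([integer_near_mod_poly]); multiplied by a
    high power of [P], the change becomes negligible. With Weierstrass's
    theorem this shows that every continuous function vanishing at the zeros
    of [P] in [K] is a uniform limit of integer multiples of [P]
    ([approx_integer_multiples]).

    It remains to compare the zeros of [P] with [J0 K]. Replacing [P] by a sum
    of even powers of elements of [BZ K], one may suppose that its zeros in
    [K] are in [J K] ([exists_BZ_zeros_in_J]). Moreover [J K] is contained in
    [J0 K] ([J_subset_J0]). Indeed, suppose that [a] in [J K] has a conjugate
    that is not in [K]. The conjugates that are in [K] are then fewer than the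
    degree of [a], and some integer polynomial of degree less than that of [a]
    is small at all of them; it does not vanish at [a]. Multiplying by an
    integer polynomial that vanishes at the other zeros of [P], but not at
    [a], and correcting by a multiple of [P], one obtains an element of [BZ K]
    that is not zero at [a], which is absurd. Finally, if [f] agrees with the
    integer polynomial [Q] on [J0 K], then [f - Q] vanishes at the zeros of
    [P] in [K], and the density of the multiples of [P] applies to it. *)

(** * Rounding coefficients *)

Section Rounding.
Variable R : realType.
Implicit Types (K : set R) (A : {poly R}) (P : {poly int}).

Lemma zevalD P Q (x : R) : zeval (P + Q) x = zeval P x + zeval Q x.
Proof. by rewrite /zeval rmorphD hornerD. Qed.

Lemma zevalB P Q (x : R) : zeval (P - Q) x = zeval P x - zeval Q x.
Proof. by rewrite /zeval rmorphB !hornerE. Qed.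

Lemma zevalM P Q (x : R) : zeval (P * Q) x = zeval P x * zeval Q x.
Proof. by rewrite /zeval rmorphM hornerM. Qed.

Lemma zevalX P n (x : R) : zeval (P ^+ n) x = zeval P x ^+ n.
Proof. by rewrite /zeval rmorphXn horner_exp. Qed.

Lemma ler_norm_horner A n (B eta x : R) :
  (size A <= n)%N -> 1 <= B -> `|x| <= B -> (forall i, `|A`_i| <= eta) ->
  `|A.[x]| <= n%:R * (eta * B ^+ n).
Proof.
move=> sA B1 xB Aeta; rewrite (horner_coef_wide _ sA).
apply: le_trans (ler_norm_sum _ _ _) _.
have -> : n%:R * (eta * B ^+ n) = \sum_(i < n) (eta * B ^+ n).
  by rewrite sumr_const card_ord mulr_natl.
apply: ler_sum => i _; rewrite normrM normrX.
apply: ler_pM => //.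
rewrite (@le_trans _ _ (B ^+ i))//.
  by rewrite lerXn2r// ?nnegrE// (le_trans _ xB).
by rewrite ler_weXn2l// ltnW.
Qed.

Definition floorp A : {poly int} := \poly_(i < size A) Num.floor A`_i.

Lemma size_floorp A : (size (floorp A) <= size A)%N.
Proof. exact: size_poly. Qed.

Lemma norm_sub_floorp A i : `|(A - map_poly intr (floorp A))`_i| <= 1.
Proof.
rewrite coefB coef_map coef_poly; case: ltnP => [_|sA].
  have := floor_le A`_i; have := floorD1_gt A`_i.
  by rewrite intrD ler_norml /= => h1 h2; apply/andP; split; lra.
by rewrite nth_default// raddf0 subrr normr0 ler01.
Qed.

(** Repeated division by [P] writes [g] as a sum of [P ^+ k * r_k] with [r_k]
    of degree less than that of [P]; rounding every [r_k] costs a geometric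
    series, whose sum does not depend on [g]. *)
Lemma integer_near_mod_poly K P (B rho : R) :
  (1 < size P)%N -> 1 <= B -> (forall x, K x -> `|x| <= B) ->
  rho < 1 -> (forall x, K x -> `|zeval P x| <= rho) ->
  exists C : R, forall g : {poly R},
    exists G : {poly int}, forall x, K x -> `|g.[x] - zeval G x| <= C.
Proof.
set d := size P => sP B1 KB rho1 Prho.
(* [C] is the fixed point of [c => rho * c + d * B ^+ d], the cost of one more
   division. *)
pose C := d%:R * B ^+ d / (1 - rho); exists C => g.
have rC : rho * C + d%:R * (1 * B ^+ d) = C.
  by rewrite /C; field; rewrite subr_eq0 gt_eqF.
have sp : size (map_poly intr P : {poly R}) = d.
  by rewrite size_map_inj_poly//; exact: intr_inj.
have p0 : map_poly intr P != 0 :> {poly R}.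
  by rewrite -size_poly_gt0 sp /d; lia.
have C0 : 0 <= C.
  by rewrite divr_ge0 ?subr_ge0 ?(ltW rho1)// mulr_ge0// exprn_ge0//; lra.
have [n] := ubnP (size g); elim: n => // n IH in g *; rewrite ltnS => sg.
have [sgd|dsg] := ltnP (size g) d.
  exists (floorp g) => x Kx.
  rewrite /zeval -hornerN -hornerD.
  apply: le_trans (@ler_norm_horner _ d B 1 x _ B1 (KB _ Kx) _) _.
  - rewrite (leq_trans (size_polyD _ _))// size_polyN geq_max (ltnW sgd)/=.
    rewrite size_map_inj_poly//; last exact: intr_inj.
    exact: leq_trans (size_floorp _) (ltnW sgd).
  - exact: norm_sub_floorp.
  - rewrite -[leRHS]rC lerDr mulr_ge0//; apply: le_trans (Prho _ Kx) => //.
pose q := g %/ map_poly intr P; pose r := g %% map_poly intr P.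
have sr : (size r < d)%N by rewrite -sp ltn_modp.
have sq : (size q < n)%N.
  by rewrite /q size_divp// sp; move: sg dsg sP; move: (size g) (d) => a b; lia.
have [G Gq] := IH q sq; exists (G * P + floorp r) => x Kx.
rewrite (divp_eq g (map_poly intr P)) -/q -/r hornerD hornerM.
rewrite zevalD zevalM.
have -> : q.[x] * (map_poly intr P).[x] + r.[x] -
  (zeval G x * zeval P x + zeval (floorp r) x) =
  (q.[x] - zeval G x) * zeval P x + (r - map_poly intr (floorp r)).[x].
  by rewrite /zeval hornerD hornerN; ring.
rewrite -[leRHS]rC [X in _ <= X + _]mulrC; apply: le_trans (ler_normD _ _) _.
apply: lerD; first by rewrite normrM ler_pM// ?Gq ?Prho.
apply: ler_norm_horner => //; last exact: norm_sub_floorp.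
- rewrite (leq_trans (size_polyD _ _))// size_polyN geq_max (ltnW sr)/=.
  rewrite size_map_inj_poly//; last exact: intr_inj.
  exact: leq_trans (size_floorp _) (ltnW sr).
- exact: KB.
Qed.

(** The fractional parts of the [M] coefficients of [A t] are a point of the
    unit cube. Cut the cube into cells of side [D^-1]: infinitely many values
    of [t] cannot all give different cells. *)
Lemma pigeonhole_frac (A : nat -> {poly R}) (M D : nat) :
  (0 < D)%N -> (forall t, (size (A t) <= M)%N) ->
  exists s t (I : {poly int}), [/\ (s < t)%N, (size I <= M)%N &
    forall i, `|(A t - A s - map_poly intr I)`_i| <= D%:R^-1].
Proof.
move=> D0 sA.
have D0R : 0 < D%:R :> R by rewrite ltr0n.
pose fr (a : R) := a - (Num.floor a)%:~R.
have fr0 a : 0 <= fr a by rewrite subr_ge0 floor_le.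
have fr1 a : fr a < 1 by rewrite ltrBlDl -[X in _ + X]/(1%:~R) -intrD floorD1_gt.
have cellP a : (Num.truncn (fr a * D%:R) < D)%N.
  rewrite -(ltr_nat R); apply: le_lt_trans (_ : fr a * D%:R < _).
    by rewrite truncn_le mulr_ge0// fr0.
  by rewrite -[ltRHS]mul1r ltr_pM2r.
pose cell a : 'I_D := Ordinal (cellP a).
have cell_near a b : cell a = cell b -> `|fr a - fr b| <= D%:R^-1.
  move=> /(congr1 val)/= ab.
  have := truncnS_gt (fr a * D%:R); have := truncnS_gt (fr b * D%:R).
  have : (Num.truncn (fr a * D%:R))%:R <= fr a * D%:R.
    by rewrite truncn_le mulr_ge0// fr0.
  have : (Num.truncn (fr b * D%:R))%:R <= fr b * D%:R.
    by rewrite truncn_le mulr_ge0// fr0.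
  rewrite ab; set k := Num.truncn _; rewrite -addn1 natrD => h1 h2 h3 h4.
  rewrite -[leRHS]mul1r ler_pdivlMr// -[X in _ * X]gtr0_norm// -normrM.
  by rewrite mulrBl ler_norml; apply/andP; split; lra.
pose N := #|{: {ffun 'I_M -> 'I_D}}|.
pose c (t : 'I_N.+1) : {ffun 'I_M -> 'I_D} := [ffun i : 'I_M => cell (A t)`_i].
have /injectivePn[s [t st cst]] : ~~ injectiveb c.
  apply/negP => /injectiveP /leq_card; rewrite card_ord -/N ltnn //.
wlog lt_st : s t st cst / (s < t)%N.
  move=> H; have /orP[?|?] : (s < t)%N || (t < s)%N by rewrite -neq_ltn.
    exact: H cst _.
  by apply: (H t s) => //; rewrite eq_sym.
pose I := \poly_(i < M) (Num.floor (A t)`_i - Num.floor (A s)`_i).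
exists s, t, I; split => //; first exact: size_poly.
move=> i; rewrite !coefB coef_map coef_poly; case: ltnP => [iM|Mi]; last first.
  by rewrite !nth_default ?(leq_trans (sA _))// !subrr normr0 invr_ge0.
have := congr1 (fun h : {ffun 'I_M -> 'I_D} => h (Ordinal iM)) cst.
rewrite !ffunE /= => /esym/cell_near; rewrite /fr rmorphB /=.
by congr (`|_| <= _); ring.
Qed.

End Rounding.

(** * A small nonzero integer polynomial *)

Section SmallIntegerPolynomial.
Variable R : realType.
Implicit Types (K : set R) (A : {poly R}) (P : {poly int}).

Lemma expr_small (r e : R) : 0 <= r -> r < 1 -> 0 < e ->
  exists N, forall n, (N <= n)%N -> r ^+ n <= e.
Proof.
move=> r0 r1 e0.
have /cvgrPdist_le/(_ e e0)[N _ HN] : (fun n => r ^+ n) @ \oo --> (0 : R).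
  by apply: cvg_expr; rewrite ger0_norm.
exists N => n /HN; rewrite sub0r normrN ger0_norm//; exact: exprn_ge0.
Qed.

Lemma expr_small1 (r e : R) : 0 <= r -> r < 1 -> 0 < e ->
  exists n, r ^+ n <= e.
Proof. by move=> r0 r1 /(expr_small r0 r1)[N HN]; exists N; exact: HN. Qed.

(** Top-down rounding: the coefficient of degree [n] becomes an integer after
    subtracting a fraction of the monic polynomial [b n], whose norm is only
    [r ^+ n] on [K]. The total cost is a geometric series. *)
Lemma integer_top_coefs K (b : nat -> {poly R}) (M : nat) (r : R) :
  r < 1 ->
  (forall n, (M <= n)%N -> [/\ b n \is monic, size (b n) = n.+1 &
      forall x, K x -> `|(b n).[x]| <= r ^+ n]) ->
  forall n A, (M <= n)%N -> (size A <= n)%N ->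
  exists I : {poly int}, exists L : {poly R},
    [/\ (size I <= n)%N, (size L <= M)%N &
      forall x, K x ->
        `|A.[x] - zeval I x - L.[x]| <= (r ^+ M - r ^+ n) / (1 - r)].
Proof.
move=> r1 bP; elim=> [|n IH] A.
  rewrite leqn0 => /eqP -> sA; exists 0, A; split; rewrite ?size_poly0// => x _.
  by rewrite /zeval rmorph0 horner0 subr0 !subrr normr0 mul0r.
rewrite leq_eqVlt => /predU1P[->|]; first move=> sA.
  exists 0, A; split; rewrite ?size_poly0// => x _.
  by rewrite /zeval rmorph0 horner0 subr0 !subrr normr0 mul0r.
rewrite ltnS => Mn sA; have [bm sb bK] := bP n Mn.
pose a := A`_n; pose f := a - (Num.floor a)%:~R.
pose A' := A - f *: b n - (Num.floor a)%:~R *: 'X^n.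
have bn : (b n)`_n = 1 by move/monicP: bm; rewrite lead_coefE sb.
have sA' : (size A' <= n)%N.
  apply/leq_sizeP => j; rewrite leq_eqVlt => /predU1P[<-|nj].
    rewrite !coefB !coefZ coefXn eqxx bn -/a /f /=; ring.
  rewrite !coefB !coefZ coefXn gtn_eqF// !nth_default ?sb//=; first ring.
  exact: leq_trans sA nj.
have [I [L [sI sL IL]]] := IH A' Mn sA'.
exists (I + Num.floor a *: 'X^n), L; split => //.
  rewrite (leq_trans (size_polyD _ _))// geq_max (leqW sI)/=.
  by rewrite (leq_trans (size_scale_leq _ _))// size_polyXn.
move=> x Kx.
have -> : A.[x] - zeval (I + Num.floor a *: 'X^n) x - L.[x] =
    (A'.[x] - zeval I x - L.[x]) + f * (b n).[x].
  rewrite zevalD /A' /zeval linearZ/= map_polyXn !hornerE; ring.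
apply: le_trans (ler_normD _ _) _.
have -> : (r ^+ M - r ^+ n.+1) / (1 - r) = (r ^+ M - r ^+ n) / (1 - r) + r ^+ n.
  by rewrite exprS; field; rewrite subr_eq0 gt_eqF.
apply: lerD; first exact: IL.
rewrite normrM -[leRHS]mul1r ler_pM ?bK//.
have := floor_le a; have := floorD1_gt a; rewrite intrD /f => h1 h2.
by rewrite ler_norml; apply/andP; split; lra.
Qed.

(** Rounding the polynomials [b n] leaves remainders [L] of degree less than
    [M], two of which agree up to an integer polynomial [J] and a small error.
    The difference of the two rounded polynomials, corrected by [J], is then
    close to a difference of two [b n], hence small on [K]; it is not zero
    because the two [b n] are monic of different degrees. *)
Lemma small_integer_poly K (b : nat -> {poly R}) (N : nat) (B r : R) :
  1 <= B -> (forall x, K x -> `|x| <= B) -> 0 <= r -> r < 1 ->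
  (forall n, (N <= n)%N -> [/\ b n \is monic, size (b n) = n.+1 &
      forall x, K x -> `|(b n).[x]| <= r ^+ n]) ->
  exists2 P : {poly int}, P != 0 &
    exists2 rho : R, rho < 1 & forall x, K x -> `|zeval P x| <= rho.
Proof.
move=> B1 KB r0 r1 bP.
(* The error has five terms, each of them made at most [1 / 8]. *)
have e0 : 0 < (1 - r) / 8 by rewrite divr_gt0// subr_gt0.
have [m Hm] := expr_small r0 r1 e0.
pose M := maxn m N.
have bPM n : (M <= n)%N -> [/\ b n \is monic, size (b n) = n.+1 &
      forall x, K x -> `|(b n).[x]| <= r ^+ n].
  by rewrite geq_max => /andP[_ /bP].
have small n : (M <= n)%N -> r ^+ n <= 8^-1.
  rewrite geq_max => /andP[/Hm rn _]; apply: le_trans rn _; lra.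
have smallM : r ^+ M / (1 - r) <= 8^-1.
  rewrite ler_pdivrMr ?subr_gt0// mulrC; apply: Hm; exact: leq_maxl.
(* The leading term is set aside, to keep the degree of the rounded polynomial
   under control. *)
have sbX t : (size (b (M + t)%N - 'X^(M + t)%N)%R <= M + t)%N.
  have [bm sb _] := bPM (M + t)%N (leq_addr _ _).
  apply/leq_sizeP => j; rewrite leq_eqVlt coefB coefXn => /predU1P[<-|tj].
    by move/monicP: bm; rewrite lead_coefE sb eqxx /= => ->; rewrite subrr.
  by rewrite gtn_eqF// nth_default ?sb// subrr.
have /choice[I /choice[L IL]] t : exists I : {poly int}, exists L : {poly R},
    [/\ (size I <= M + t)%N, (size L <= M)%N &
      forall x, K x -> `|(b (M + t)%N - 'X^(M + t)%N).[x] - zeval I x - L.[x]|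
        <= (r ^+ M - r ^+ (M + t)%N) / (1 - r)].
  by apply: (integer_top_coefs r1 bPM); rewrite ?leq_addr.
pose D := (Num.truncn (8 * (M%:R * B ^+ M))).+1.
have [s [t [J [st sJ sJL]]]] := @pigeonhole_frac R L M D isT
  (fun t => let: And3 _ sL _ := IL t in sL).
have [sIs sLs ILs] := IL s; have [sIt sLt ILt] := IL t.
pose P := 'X^(M + t)%N + (I t - 'X^(M + s)%N - I s + J).
exists P.
  have sP : (size (I t - 'X^(M + s)%N - I s + J)%R <
             size ('X^(M + t)%N : {poly int}))%N.
    rewrite size_polyXn ltnS (leq_trans (size_polyD _ _))// geq_max.
    rewrite (leq_trans sJ) ?leq_addr// andbT.
    rewrite (leq_trans (size_polyD _ _))// geq_max size_polyN.
    rewrite (leq_trans sIs) ?leq_add2l ?(ltnW st)// andbT.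
    rewrite (leq_trans (size_polyD _ _))// geq_max size_polyN sIt.
    by rewrite size_polyXn ltn_add2l.
  by rewrite -size_poly_gt0 size_polyDl// size_polyXn.
exists (5 / 8); first lra.
move=> x Kx.
have [_ _ bs] := bPM (M + s)%N (leq_addr _ _).
have [_ _ bt] := bPM (M + t)%N (leq_addr _ _).
have -> : zeval P x = (b (M + t)%N).[x] - (b (M + s)%N).[x]
  - ((b (M + t)%N - 'X^(M + t)%N).[x] - zeval (I t) x - (L t).[x])
  + ((b (M + s)%N - 'X^(M + s)%N).[x] - zeval (I s) x - (L s).[x])
  - (L t - L s - map_poly intr J).[x].
  rewrite /P 2!zevalD 2!zevalB /zeval !map_polyXn.
  rewrite !(hornerD, hornerN, hornerXn); ring.
have h1 := le_trans (bt _ Kx) (small _ (leq_addr _ _)).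
have h2 := le_trans (bs _ Kx) (small _ (leq_addr _ _)).
have geo k : (r ^+ M - r ^+ (M + k)%N) / (1 - r) <= 8^-1.
  apply: le_trans smallM; rewrite ler_pM2r ?invr_gt0 ?subr_gt0//.
  by rewrite gerBl exprn_ge0.
have h3 := le_trans (ILt _ Kx) (geo _).
have h4 := le_trans (ILs _ Kx) (geo _).
have sLJ : (size (L t - L s - map_poly intr J : {poly R})%R <= M)%N.
  rewrite (leq_trans (size_polyD _ _))// size_polyN geq_max.
  rewrite size_map_inj_poly ?sJ ?andbT//; last exact: intr_inj.
  by rewrite (leq_trans (size_polyD _ _))// size_polyN geq_max sLt.
have h5 := ler_norm_horner sLJ B1 (KB _ Kx) sJL.
have h6 : M%:R * (D%:R^-1 * B ^+ M) <= 8^-1 :> R.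
  rewrite mulrCA mulrC ler_pdivrMr ?ltr0n//.
  have := truncnS_gt (8 * (M%:R * B ^+ M)); rewrite -/D; lra.
rewrite ler_norml; move: h1 h2 h3 h4 (le_trans h5 h6).
rewrite !ler_norml => /andP[? ?] /andP[? ?] /andP[? ?] /andP[? ?] /andP[? ?].
by apply/andP; split; lra.
Qed.

End SmallIntegerPolynomial.

(** * Weierstrass approximation on a compact subset of the line *)

Section Weierstrass.
Variable R : realType.
Implicit Types (K : set R) (f : R -> R).

Lemma compact_ler_norm K f : compact K -> continuous f ->
  exists2 M : R, 0 < M & forall x, K x -> `|f x| <= M.
Proof.
move=> cK cf.
have : compact (f @` K).
  by apply: continuous_compact => //; exact: continuous_subspaceT.
move=> /compact_bounded/ex_strict_bound_gt0[M M0 HM].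
by exists M => // x Kx; apply/ltW/HM; exists x.
Qed.

Lemma closed_preimage_ge (T : topologicalType) (g : T -> R) (e : R) :
  continuous g -> closed [set z | e <= g z].
Proof.
move=> cg; have := closed_comp (fun z _ => cg z) (@closed_ge R e).
exact.
Qed.

(** Uniform continuity in a form to which a bound on a variance applies: the
    pairs of points between which [f] varies by at least [e] form a compact
    set that does not meet the diagonal, so their distance is bounded below. *)
Lemma quadratic_modulus K f (e : R) : compact K -> continuous f -> 0 < e ->
  exists2 C : R, 0 <= C & forall x y, K x -> K y ->
    `|f x - f y| <= e + C * (x - y) ^+ 2.
Proof.
move=> cK cf e0; have [M M0 fM] := compact_ler_norm cK cf.
pose g (z : R * R) := `|f z.1 - f z.2|.
have cg : continuous g.
  move=> z; apply: cvg_norm; apply: cvgB.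
    by apply: continuous_comp; [exact: cvg_fst|exact: cf].
  by apply: continuous_comp; [exact: cvg_snd|exact: cf].
pose A := (K `*` K) `&` [set z | e <= g z].
have cA : compact A.
  by apply: compact_closedI; [exact: compact_setX|exact: closed_preimage_ge].
have [A0|/set0P/negP] := pselect (A !=set0); last first.
  rewrite negbK => /eqP A0; exists 0 => // x y Kx Ky.
  rewrite mul0r addr0 leNgt; apply/negP => /ltW exy.
  by have : A (x, y) by []; rewrite A0.
have ch : {within A, continuous (fun z : R * R => (z.1 - z.2) ^+ 2)}.
  apply: continuous_subspaceT => z.
  have cd : continuous (fun z : R * R => z.1 - z.2).
    by move=> w; apply: cvgB; [exact: cvg_fst|exact: cvg_snd].
  apply: (@continuous_comp _ _ _ (fun z : R * R => z.1 - z.2)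
                                 (fun w : R => w ^+ 2)); first exact: cd.
  exact: exprn_continuous.
have [c cA' cmin] := compact_EVT_min A0 cA ch.
have d0 : 0 < (c.1 - c.2) ^+ 2.
  rewrite exprn_even_gt0//= subr_eq0; apply/eqP => c12.
  move: cA'; rewrite inE => -[_]; rewrite /= /g c12 subrr normr0.
  by rewrite leNgt e0.
exists (2 * M / (c.1 - c.2) ^+ 2).
  by rewrite divr_ge0 ?(ltW d0)// mulr_ge0// ltW.
move=> x y Kx Ky; have [exy|/ltW exy] := leP e (g (x, y)); last first.
  apply: le_trans exy _; rewrite lerDl mulr_ge0 ?sqr_ge0//.
  by rewrite divr_ge0 ?(ltW d0)// mulr_ge0// ltW.
have /cmin/= cxy : (x, y) \in A by rewrite inE.
apply: (@le_trans _ _ (2 * M)).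
  by apply: le_trans (ler_normB _ _) _; rewrite mulr_natl mulr2n lerD ?fM.
rewrite -[leLHS]add0r lerD ?(ltW e0)//.
rewrite -mulrA -[leLHS]mulr1 ler_pM2l ?mulr_gt0// mulrC.
by rewrite ler_pdivlMr// mul1r.
Qed.

(** De Casteljau's recursion for the Bernstein polynomial
    [\sum_(k < n.+1) 'C(n, k) * U ^+ k * V ^+ (n - k) * g k]: its value is the
    mean of [g] at the number of successes in [n] independent trials of
    probability [U], and moments are computed by induction. *)
Fixpoint bernstein (U V : {poly R}) (n : nat) (g : nat -> R) : {poly R} :=
  if n is m.+1 then V * bernstein U V m g + U * bernstein U V m (g \o S)
  else (g 0%N)%:P.

Section BernsteinMoments.
Variables (U V : {poly R}) (x : R).
Hypothesis UV1 : U.[x] + V.[x] = 1.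

Lemma bernstein_subl n c g :
  (bernstein U V n (fun k => c - g k)).[x] = c - (bernstein U V n g).[x].
Proof.
elim: n g => [|n IH] g /=; first by rewrite !hornerE.
rewrite !(hornerD, hornerM) IH (IH (g \o S)).
by rewrite -[X in _ = X - _]mul1r -UV1; ring.
Qed.

Lemma bernstein_quadratic n e a c :
  (bernstein U V n (fun k => e + a * (k%:R + c) ^+ 2)).[x] =
  e + a * ((n%:R * U.[x] + c) ^+ 2 + n%:R * U.[x] * V.[x]).
Proof.
have v : V.[x] = 1 - U.[x] by rewrite -UV1 addrC addKr.
elim: n c => [|n IH] c /=; first by rewrite !hornerE; ring.
rewrite !(hornerD, hornerM) IH.
have -> : (fun k => e + a * (k%:R + c) ^+ 2) \o S =
    (fun k => e + a * (k%:R + (1 + c)) ^+ 2).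
  by apply/funext => k /=; rewrite -addn1 natrD addrA.
by rewrite IH v -[n.+1]addn1 natrD; ring.
Qed.

Hypotheses (U0 : 0 <= U.[x]) (V0 : 0 <= V.[x]).

Lemma bernstein_norm_le n g h : (forall k, `|g k| <= h k) ->
  `|(bernstein U V n g).[x]| <= (bernstein U V n h).[x].
Proof.
elim: n g h => [|n IH] g h gh /=; first by rewrite !hornerC.
rewrite !(hornerD, hornerM) (le_trans (ler_normD _ _))//.
rewrite lerD// normrM ger0_norm// ler_wpM2l// IH// => k; exact: gh.
Qed.

End BernsteinMoments.

(** Weierstrass's theorem on a compact subset of the line. The values [f] at
    the nodes [t k] of an interval containing [K] are replaced by values at
    the nearest points [y k] of [K], which at most doubles the distance to
    [x]. *)
Lemma weierstrass K f (e : R) : compact K -> K !=set0 -> continuous f -> 0 < e ->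
  exists p : {poly R}, forall x, K x -> `|f x - p.[x]| <= e.
Proof.
move=> cK K0 cf e0.
have [B B0 KB] := @compact_ler_norm K id cK (fun x => cvg_id).
have e20 : 0 < e / 2 by rewrite divr_gt0.
have [C C0 fC] := quadratic_modulus cK cf e20.
pose n := (Num.truncn (32 * C * B ^+ 2 / e)).+1.
pose t k : R := - B + 2 * B / n%:R * k%:R.
have n0 : 0 < n%:R :> R by rewrite ltr0n.
have /choice[y yP] k : exists y, K y /\ forall x, K x -> `|t k - y| <= `|t k - x|.
  have ct : {within K, continuous (fun y => `|t k - y|)}.
    apply: continuous_subspaceT => z; apply: cvg_norm; apply: cvgB => //.
    exact: cvg_cst.
  have [c] := compact_EVT_min K0 cK ct; rewrite inE => Kc cmin.
  by exists c; split=> // x Kx; apply: cmin; rewrite inE.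
pose U : {poly R} := (2 * B)^-1 *: ('X + B%:P).
pose V : {poly R} := (2 * B)^-1 *: (B%:P - 'X).
(* [U] and [V] are the barycentric coordinates of [x] between [- B] and [B]. *)
exists (bernstein U V n (f \o y)) => x Kx.
have Bn0 : B != 0 by rewrite gt_eqF.
have Ux : U.[x] = (2 * B)^-1 * (x + B) by rewrite !hornerE.
have Vx : V.[x] = (2 * B)^-1 * (B - x) by rewrite !hornerE.
have UV1 : U.[x] + V.[x] = 1 by rewrite Ux Vx; field.
have := KB x Kx; rewrite ler_norml => /andP[xB Bx].
have U0 : 0 <= U.[x] by rewrite Ux mulr_ge0 ?invr_ge0; lra.
have V0 : 0 <= V.[x] by rewrite Vx mulr_ge0 ?invr_ge0; lra.
rewrite -(bernstein_subl UV1).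
pose h k := e / 2 +
  (16 * C * B ^+ 2 / n%:R ^+ 2) * (k%:R + - (n%:R * U.[x])) ^+ 2.
have fh k : `|f x - (f \o y) k| <= h k.
  have [Ky yx] := yP k; apply: le_trans (fC _ _ Kx Ky) _.
  rewrite lerD2l.
  have -> : 16 * C * B ^+ 2 / n%:R ^+ 2 * (k%:R + - (n%:R * U.[x])) ^+ 2 =
      C * (4 * (x - t k) ^+ 2).
    rewrite Ux /t; field; by rewrite Bn0 gt_eqF.
  rewrite ler_wpM2l//.
  have d : `|x - y k| <= 2 * `|x - t k|.
    have -> : x - y k = (x - t k) + (t k - y k) by ring.
    rewrite (le_trans (ler_normD _ _))// mulr_natl mulr2n lerD2l.
    by rewrite [leRHS]distrC yx.
  rewrite -real_normK ?num_real// -[X in _ <= _ * X]real_normK ?num_real//.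
  have -> : 4 * `|x - t k| ^+ 2 = (2 * `|x - t k|) ^+ 2 by ring.
  by rewrite lerXn2r ?nnegrE// mulr_ge0.
apply: le_trans (bernstein_norm_le U0 V0 n fh) _.
rewrite /h (bernstein_quadratic UV1) subrr.
have -> : 16 * C * B ^+ 2 / n%:R ^+ 2 * (0 ^+ 2 + n%:R * U.[x] * V.[x]) =
    (16 * C * B ^+ 2 / n%:R) * (U.[x] * V.[x]).
  by field; rewrite gt_eqF.
rewrite [leRHS]splitr lerD2l.
have D0 : 0 <= 16 * C * B ^+ 2 by apply: mulr_ge0; [apply: mulr_ge0|exact: sqr_ge0].
apply: (@le_trans _ _ (16 * C * B ^+ 2 / n%:R)).
  rewrite -[leRHS]mulr1 ler_wpM2l ?divr_ge0 ?(ltW n0)// -[leRHS]mulr1 ler_pM//; lra.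
rewrite ler_pdivrMr//.
have := truncnS_gt (32 * C * B ^+ 2 / e); rewrite -/n ltr_pdivrMr//; lra.
Qed.

End Weierstrass.

(** * Integer polynomials of norm less than one *)

Section SupNorm.
Variable R : realType.
Implicit Types (K : set R) (f : R -> R) (P Q G : {poly int}).

Lemma ler_supnorm K f x : compact K -> continuous f -> K x ->
  `|f x| <= supnorm K f.
Proof.
move=> cK cf Kx; have [M M0 fM] := compact_ler_norm cK cf.
by apply: ub_le_sup; [exists M => _ [y Ky <-]; exact: fM|exists x].
Qed.

Lemma supnorm_le K f (c : R) : K !=set0 -> (forall x, K x -> `|f x| <= c) ->
  supnorm K f <= c.
Proof.
move=> [x Kx] fc; apply: ge_sup; first by exists `|f x|, x.
by move=> _ [y Ky <-]; exact: fc.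
Qed.

Lemma continuous_zeval P : continuous (zeval P : R -> R).
Proof. exact: continuous_horner. Qed.

Lemma BZP K P : compact K -> K !=set0 ->
  BZ K P <-> exists2 rho : R, rho < 1 & forall x, K x -> `|zeval P x| <= rho.
Proof.
move=> cK K0; split=> [BP|[rho rho1 Prho]].
  exists (supnorm K (zeval P)) => // x Kx.
  exact: ler_supnorm (@continuous_zeval P) Kx.
by apply: le_lt_trans rho1; exact: supnorm_le.
Qed.

Lemma BZ_size_gt1 K P : compact K -> K !=set0 -> BZ K P -> P != 0 ->
  (1 < size P)%N.
Proof.
move=> cK K0 /(BZP _ cK K0)[rho rho1 Prho] P0; rewrite ltnNge; apply/negP.
move=> /size1_polyC Pc; have [x Kx] := K0.
(* A nonzero constant integer has norm at least one. *)
have c0 : P`_0 != 0 by move: P0; rewrite Pc polyC_eq0 coefC eqxx.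
have := le_lt_trans (Prho x Kx) rho1.
rewrite Pc /zeval map_polyC hornerC -intr_norm ltrz1.
by move: c0; rewrite -normr_gt0; lia.
Qed.

End SupNorm.

(** * Approximation by the integer multiples of a polynomial *)

Section Ideal.
Variable R : realType.
Implicit Types (K : set R) (f : R -> R) (P Q G : {poly int}).

(** The quotient of [f] by [p ^+ k] need not be continuous at the zeros of
    [p], but [f * p ^+ k / (p ^+ (2 * k) + h)] is, for all [h > 0]. When [h]
    is small, multiplying it back by [p ^+ k] changes [f] notably only near
    the zeros of [p] in [K], where [f] is small. *)
Lemma continuous_quotient K f (p : {poly R}) k (e : R) :
  compact K -> continuous f -> (forall x, K x -> p.[x] = 0 -> f x = 0) ->
  0 < e -> exists2 g : R -> R, continuous g &
    forall x, K x -> `|f x - p.[x] ^+ k * g x| <= e.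
Proof.
move=> cK cf f0 e0; have [M M0 fM] := compact_ler_norm cK cf.
pose s x := (p ^+ k).[x] ^+ 2.
have s0 x : 0 <= s x by rewrite sqr_ge0.
have cs : continuous s.
  move=> x; apply: (@continuous_comp _ _ _ (fun x => (p ^+ k).[x])
                                           (fun w : R => w ^+ 2)).
    exact: continuous_horner.
  exact: exprn_continuous.
pose A := K `&` [set x | e <= `|f x|].
have cA : compact A.
  apply: compact_closedI => //; apply: closed_preimage_ge => x.
  by apply: cvg_norm; exact: cf.
have [c c0 sc] : exists2 c, 0 < c & forall x, A x -> c <= s x.
  have [A0|/set0P/negP] := pselect (A !=set0); last first.
    by rewrite negbK => /eqP A0; exists 1 => // x; rewrite A0.
  have [y] := compact_EVT_min A0 cA (continuous_subspaceT cs).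
  rewrite inE => -[Ky ey] smin; exists (s y) => [|x Ax]; last first.
    by apply: smin; rewrite inE.
  rewrite lt0r s0 andbT sqrf_eq0 horner_exp expf_eq0 negb_and -leqNgt.
  apply/orP; right; apply/eqP => /(f0 y Ky) fy0.
  by move: ey; rewrite /= fy0 normr0 leNgt e0.
(* Where [`|f| >= e], the relative change is at most [h / c = e / M]. *)
pose h := c * e / M.
have h0 : 0 < h by rewrite divr_gt0// mulr_gt0.
have sh x : 0 < s x + h by rewrite ltr_wpDl.
exists (fun x => f x * (p ^+ k).[x] / (s x + h)).
  move=> x; apply: cvgM.
    by apply: cvgM; [exact: cf|exact: continuous_horner].
  apply: cvgV; first by rewrite gt_eqF.
  by apply: cvgD; [exact: cs|exact: cvg_cst].
move=> x Kx; rewrite -horner_exp.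
have -> : f x - (p ^+ k).[x] * (f x * (p ^+ k).[x] / (s x + h)) =
    f x * (h / (s x + h)).
  by rewrite /s; field; rewrite -/(s x) gt_eqF.
have hs1 : 0 <= h / (s x + h) <= 1.
  rewrite divr_ge0 ?(ltW h0) ?(ltW (sh x))//= ler_pdivrMr// mul1r lerDr//.
rewrite normrM (ger0_norm (proj1 (andP hs1))).
have [/ltW fe|ef] := ltP `|f x| e.
  by rewrite -[leRHS]mulr1 ler_pM//; case/andP: hs1.
have csx : c <= s x by apply: sc; split.
apply: (@le_trans _ _ (M * (h / c))).
  case/andP: hs1 => ? ?; apply: ler_pM => //; first exact: fM.
  rewrite ler_pM2l// lef_pV2 ?posrE//; lra.
rewrite /h le_eqVlt; apply/orP; left; apply/eqP; field.
by rewrite !gt_eqF.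
Qed.

(** By [continuous_quotient] and Weierstrass's theorem, [f] is close to
    [P ^+ m.+1 * q] for some real polynomial [q]. Rounding [q] costs a constant
    independent of [m], which the factor [P ^+ m.+1] makes negligible. *)
Lemma approx_integer_multiples K P f (e : R) :
  compact K -> K !=set0 -> BZ K P -> P != 0 ->
  continuous f -> (forall x, K x -> zeval P x = 0 -> f x = 0) -> 0 < e ->
  exists G : {poly int}, forall x, K x -> `|f x - zeval (P * G) x| <= e.
Proof.
move=> cK K0 BP P0 cf f0 e0.
have sP := BZ_size_gt1 cK K0 BP P0.
have [rho rho1 Prho] := (BZP _ cK K0).1 BP.
have [B B0 KB] := @compact_ler_norm _ K id cK (fun x => cvg_id).
have B1 : 1 <= B + 1 by lra.
have KB1 x : K x -> `|x| <= B + 1 by move=> /KB /= ?; lra.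
have [C0 HC0] := integer_near_mod_poly sP B1 KB1 rho1 Prho.
pose C := Num.max C0 1.
have C0' : 0 < C by rewrite lt_max ltr01 orbT.
have rho0 : 0 <= rho by case: K0 => y Ky; apply: le_trans (Prho y Ky).
have e3 : 0 < e / 3 by rewrite divr_gt0.
have [m Hm] := expr_small1 rho0 rho1 (divr_gt0 e3 C0').
have rm : rho ^+ m.+1 * C <= e / 3.
  rewrite -ler_pdivlMr//; apply: le_trans Hm.
  by rewrite exprS ler_piMl ?exprn_ge0// ltW.
have [g cg fg] := @continuous_quotient K f (map_poly intr P) m.+1 _ cK cf f0 e3.
have [q gq] := weierstrass cK K0 cg e3.
have [G qG] := HC0 q.
exists (P ^+ m * G) => x Kx.
have Px1 : `|zeval P x ^+ m.+1| <= 1.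
  rewrite normrX exprn_ile1//; apply: le_trans (Prho x Kx) (ltW rho1).
rewrite mulrA -exprS zevalM zevalX.
have -> : f x - zeval P x ^+ m.+1 * zeval G x =
  (f x - zeval P x ^+ m.+1 * g x) + zeval P x ^+ m.+1 * (g x - q.[x])
  + zeval P x ^+ m.+1 * (q.[x] - zeval G x) by ring.
have h1 := fg x Kx; rewrite -/(zeval P x) in h1.
have h2 : `|zeval P x ^+ m.+1 * (g x - q.[x])| <= e / 3.
  by rewrite normrM -[leRHS]mul1r ler_pM// gq.
have h3 : `|zeval P x ^+ m.+1 * (q.[x] - zeval G x)| <= e / 3.
  rewrite normrM; apply: le_trans rm; apply: ler_pM => //.
    rewrite normrX; apply: lerXn2r; rewrite ?nnegrE//; exact: Prho.
  by apply: le_trans (qG x Kx) _; rewrite /C le_max lexx.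
rewrite (le_trans (ler_normD _ _))//.
have := ler_normD (f x - zeval P x ^+ m.+1 * g x)
                  (zeval P x ^+ m.+1 * (g x - q.[x])).
lra.
Qed.

End Ideal.

(** * Capacity and Chebyshev polynomials *)

Section Fekete.
Variable R : realType.

Lemma rootn_le (a s : R) n : (0 < n)%N -> 0 <= a -> 0 <= s ->
  (a `^ n%:R^-1 <= s) = (a <= s ^+ n).
Proof.
move=> n0 a0 s0; have nn0 : n%:R != 0 :> R by rewrite pnatr_eq0 -lt0n.
apply/idP/idP => [us|asn].
  have -> : a = (a `^ n%:R^-1) ^+ n.
    by rewrite -powR_mulrn ?powR_ge0// -powRrM mulVf// powRr1.
  by rewrite lerXn2r ?nnegrE// powR_ge0.
have -> : s = (s ^+ n) `^ n%:R^-1.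
  by rewrite -powR_mulrn// -powRrM divff// powRr1.
by rewrite ge0_ler_powR ?nnegrE ?invr_ge0 ?exprn_ge0// ler0n.
Qed.

(** Fekete's lemma in multiplicative form. The limit is the infimum of the
    [m]-th roots of the [a m]: if [a m <= rho ^+ m] for one [m], Euclidean
    division by [m] gives [a n <= C * rho ^+ n] for all [n], and the [n]-th
    root of [C] tends to [1]. *)
Lemma submultiplicative_root_cvg (a : nat -> R) :
  (forall n, 0 <= a n) -> (forall m n, a (m + n)%N <= a m * a n) ->
  cvgn (fun n => a n `^ n%:R^-1).
Proof.
move=> a0 aM; pose u n := a n `^ n%:R^-1.
pose E := [set u n | n in [set n | (0 < n)%N]].
have lbE : has_lbound E by exists 0 => _ [n _ <-]; exact: powR_ge0.
have E0 : E !=set0 by exists (u 1%N), 1%N.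
apply/cvg_ex; exists (inf E); apply/cvgrPdist_le => /= eps eps0.
have eps20 : 0 < eps / 2 by rewrite divr_gt0.
have [_ [m /= m0 <-] um] := inf_adherent eps20 (conj E0 lbE).
set rho := inf E + eps / 2 in um.
have rho0 : 0 < rho by apply: le_lt_trans um; exact: powR_ge0.
have am : a m <= rho ^+ m by rewrite -rootn_le// ltW.
pose C := 1 + \sum_(r < m) a r / rho ^+ r.
have ar r : (r < m)%N -> a r <= C * rho ^+ r.
  move=> rm; rewrite -ler_pdivrMr ?exprn_gt0//.
  rewrite /C (bigD1 (Ordinal rm))//= addrCA lerDl addr_ge0// sumr_ge0// => i _.
  by rewrite divr_ge0// exprn_ge0// ltW.
have C0 : 0 < C.
  rewrite ltr_wpDr// sumr_ge0// => i _; by rewrite divr_ge0// exprn_ge0// ltW.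
have aq q r : a (q * m + r)%N <= rho ^+ (q * m) * a r.
  elim: q => [|q IH]; first by rewrite mul0n add0n expr0 mul1r.
  rewrite mulSn -addnA (le_trans (aM _ _))// exprD -mulrA.
  by rewrite ler_pM.
have an n : a n <= C * rho ^+ n.
  rewrite {1}(divn_eq n m) (le_trans (aq _ _))//.
  rewrite {3}(divn_eq n m) exprD mulrCA ler_wpM2l ?exprn_ge0 ?(ltW rho0)//.
  by rewrite ar// ltn_mod.
have s0 : 0 < rho + eps / 2 by rewrite addr_gt0.
have q0 : 0 <= rho / (rho + eps / 2) by rewrite divr_ge0 ?ltW.
have q1 : rho / (rho + eps / 2) < 1 by rewrite ltr_pdivrMr// mul1r ltrDl.
have Ci0 : 0 < C^-1 by rewrite invr_gt0.
have [N HN] := expr_small q0 q1 Ci0.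
exists (maxn N 1) => // n /=; rewrite geq_max => /andP[Nn n0].
have lo : inf E <= u n by apply: ge_inf => //; exists n.
have hi : u n <= rho + eps / 2.
  rewrite rootn_le ?(ltW s0)// (le_trans (an n))//.
  have := HN n Nn; rewrite expr_div_n ler_pdivrMr ?exprn_gt0//.
  by rewrite ler_pdivlMl.
rewrite -/(u n) ler_norml; move: hi; rewrite /rho => hi.
by apply/andP; split; lra.
Qed.

End Fekete.

Section Chebyshev.
Variable R : realType.
Variable K : set R.
Hypotheses (cK : compact K) (infK : infinite_set K).
Implicit Types (p q : {poly R}).

Let normK p := supnorm K (horner p).

Let K0 : K !=set0.
Proof. exact: infinite_setN0. Qed.

Lemma supnorm_horner_ub p x : K x -> `|p.[x]| <= normK p.
Proof. exact: ler_supnorm (@continuous_horner _ p). Qed.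

Lemma supnorm_horner_ge0 p : 0 <= normK p.
Proof. by have [x Kx] := K0; apply: le_trans (supnorm_horner_ub p Kx). Qed.

Lemma supnorm_hornerB_le p q : normK p <= normK q + normK (p - q).
Proof.
apply: supnorm_le => // x Kx.
have -> : p.[x] = q.[x] + (p - q).[x] by rewrite hornerD hornerN; ring.
by rewrite (le_trans (ler_normD _ _))// lerD// supnorm_horner_ub.
Qed.

Lemma supnorm_hornerN p : normK (- p) = normK p.
Proof. by congr sup; apply: eq_imagel => x _; rewrite hornerN normrN. Qed.

Lemma supnorm_hornerZ c p : normK (c *: p) <= `|c| * normK p.
Proof.
apply: supnorm_le => // x Kx.
by rewrite hornerZ normrM ler_wpM2l// supnorm_horner_ub.
Qed.

Lemma supnorm_hornerM p q : normK (p * q) <= normK p * normK q.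
Proof.
apply: supnorm_le => // x Kx.
by rewrite hornerM normrM ler_pM// supnorm_horner_ub.
Qed.

Lemma supnorm_horner_gt0 p : p != 0 -> 0 < normK p.
Proof.
move=> p0; rewrite lt0r supnorm_horner_ge0 andbT; apply/eqP => np.
have [X XK sX] := (infinite_set_fsetP K).1 infK (size p).
have Xp : all (root p) (finmap.enum_fset X).
  apply/allP => x xX; rewrite rootE -normr_eq0 eq_le normr_ge0 andbT -np.
  by apply: supnorm_horner_ub; exact: XK.
by have := max_poly_roots p0 Xp (finmap.fset_uniq X); rewrite ltnNge sX.
Qed.

Lemma normr_rV_coord n (c : 'rV[R]_n) i : `|c 0 i| <= `|c|.
Proof. by rewrite [leRHS]mx_normrE; exact: (le_bigmax _ _ (0, i)). Qed.

Lemma supnorm_rVpoly_le n : exists2 C : R, 0 < C &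
  forall c : 'rV[R]_n, normK (rVpoly c) <= C * `|c|.
Proof.
have [B B0 KB] := @compact_ler_norm _ K id cK (fun x => cvg_id).
have B1 : 1 <= B + 1 by lra.
exists (n%:R * (B + 1) ^+ n + 1).
  by rewrite ltr_wpDl// mulr_ge0// exprn_ge0//; lra.
move=> c; apply: supnorm_le => // x Kx.
apply: (@le_trans _ _ (n%:R * (`|c| * (B + 1) ^+ n))); last first.
  by rewrite [`|c| * _]mulrC mulrA ler_wpM2r// lerDl.
apply: ler_norm_horner => //; first exact: size_poly.
  by have /= := KB x Kx; lra.
move=> i; rewrite coef_rVpoly; case: insubP => [j _ _|_]; last by rewrite normr0.
exact: normr_rV_coord.
Qed.

Lemma continuous_supnorm_rVpoly n q :
  continuous (fun c : 'rV[R]_n => normK (q + rVpoly c)).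
Proof.
have [C C0 HC] := supnorm_rVpoly_le n.
have lip (c d : 'rV[R]_n) :
    normK (q + rVpoly c) - normK (q + rVpoly d) <= C * `|c - d|.
  rewrite lerBlDl (le_trans (supnorm_hornerB_le _ (q + rVpoly d)))// lerD2l.
  have -> : q + rVpoly c - (q + rVpoly d) = rVpoly (c - d) by rewrite linearB/=; ring.
  exact: HC.
move=> c; apply/(@cvgrPdist_le _ _ _ _ (nbhs_filter c)) => /= e e0.
have Fc := nbhs_filter c; near=> d.
apply: (@le_trans _ _ (C * `|c - d|)).
  rewrite ler_norml lip andbT lerNl opprB (le_trans (lip _ _))//.
  by rewrite distrC.
rewrite -ler_pdivlMl//; near: d.
apply: (@cvgr_dist_le _ _ _ _ _ _ _ (@cvg_id _ (nbhs c))).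
by rewrite mulr_gt0// invr_gt0.
Unshelve. all: end_near. Qed.

(** As [K] is infinite, the supremum on [K] is a norm on polynomials of
    bounded degree, hence comparable with the norm of the coefficients: it has
    a positive minimum on the unit sphere. *)
Lemma supnorm_rVpoly_ge n : exists2 mu : R, 0 < mu &
  forall c : 'rV[R]_n, mu * `|c| <= normK (rVpoly c).
Proof.
pose S := [set c : 'rV[R]_n | `|c| = 1].
have cS : compact S.
  apply: bounded_closed_compact.
    by exists 1; split; [exact: num_real|move=> y y1 c /= ->; exact: ltW].
  have := closed_comp (fun (c : 'rV[R]_n) _ => @norm_continuous _ _ c)
                         (@closed_eq R 1).
  exact.
have [mu mu0 Hmu] : exists2 mu, 0 < mu & forall c, S c -> mu <= normK (rVpoly c).
  have [S0|/set0P/negP] := pselect (S !=set0); last first.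
    by rewrite negbK => /eqP S0; exists 1 => // c; rewrite S0.
  have cN := continuous_subspaceT (@continuous_supnorm_rVpoly n 0).
  have [c] := compact_EVT_min S0 cS (cN S).
  rewrite inE => Sc cmin; exists (normK (rVpoly c)).
    apply: supnorm_horner_gt0; apply/eqP => /(congr1 (@poly_rV R n)).
    rewrite rVpolyK linear0 => c0; move: Sc; rewrite /S /= c0 normr0 => /eqP.
    by rewrite eq_sym oner_eq0.
  by move=> d Sd; have := cmin d; rewrite !add0r inE; exact.
exists mu => // c; have [->|c0] := eqVneq c 0.
  by rewrite normr0 mulr0 supnorm_horner_ge0.
have cn0 : 0 < `|c| by rewrite normr_gt0.
rewrite -ler_pdivlMr// mulrC.
have Sc : S (`|c|^-1 *: c).
  by rewrite /S /= normrZ normfV normr_id mulVf// gt_eqF.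
apply: le_trans (Hmu _ Sc) _; rewrite linearZ/=.
by rewrite (le_trans (supnorm_hornerZ _ _))// normfV normr_id.
Qed.

(** The norm of ['X^n + c] exceeds that of ['X^n] when [c] is large
    ([supnorm_rVpoly_ge]), so it is enough to minimize over a compact ball. *)
Lemma exists_cheb_poly n : exists T, is_cheb_poly K n T.
Proof.
have [mu mu0 Hmu] := supnorm_rVpoly_ge n.
pose rho := 2 * normK 'X^n / mu.
have rho0 : 0 <= rho by rewrite divr_ge0 ?(ltW mu0)// mulr_ge0// supnorm_horner_ge0.
pose A := [set c : 'rV[R]_n | `|c| <= rho].
have cA : compact A.
  apply: bounded_closed_compact.
    exists rho; split; [exact: num_real|move=> y y1 c /= cr].
    exact: le_trans cr (ltW y1).
  have := closed_comp (fun (c : 'rV[R]_n) _ => @norm_continuous _ _ c)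
                         (@closed_le R rho).
  exact.
have A0 : A 0 by rewrite /A /= normr0.
have [c _ cmin] := compact_EVT_min (ex_intro _ _ A0) cA
  (continuous_subspaceT (@continuous_supnorm_rVpoly n 'X^n)).
have sr (d : 'rV[R]_n) : (size (rVpoly d) < size ('X^n : {poly R}))%N.
  by rewrite size_polyXn ltnS size_poly.
exists ('X^n + rVpoly c); split.
- by rewrite monicE lead_coefDl// lead_coefXn.
- by rewrite size_polyDl// size_polyXn.
move=> P Pm sP.
have [d ->] : exists d : 'rV[R]_n, P = 'X^n + rVpoly d.
  exists (poly_rV (P - 'X^n)); rewrite poly_rV_K; first by rewrite addrC subrK.
  apply/leq_sizeP => j; rewrite leq_eqVlt coefB coefXn => /predU1P[<-|nj].
    by move/monicP: Pm; rewrite lead_coefE sP eqxx /= => ->; rewrite subrr.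
  by rewrite gtn_eqF// nth_default ?sP// subrr.
have [dA|dA] := leP `|d| rho; first by apply: cmin; rewrite inE.
apply: (@le_trans _ _ (normK ('X^n + rVpoly 0))).
  by apply: cmin; rewrite inE.
rewrite raddf0 addr0.
have h : mu * `|d| <= normK ('X^n + rVpoly d) + normK 'X^n.
  apply: le_trans (Hmu d) _.
  rewrite (le_trans (supnorm_hornerB_le _ ('X^n + rVpoly d)))// lerD2l.
  by rewrite opprD addrCA subrr addr0 supnorm_hornerN.
move: dA; rewrite /rho ltr_pdivrMr// => dA; rewrite -/(normK _) -/(normK _).
have := supnorm_horner_ge0 'X^n; lra.
Qed.

Lemma cheb_polyP n : is_cheb_poly K n (cheb_poly K n).
Proof.
have [T KT] := exists_cheb_poly n.
exact: (@xgetPex _ 0 [set T | is_cheb_poly K n T] (ex_intro _ T KT)).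
Qed.

Lemma cheb_norm_submultiplicative m n :
  normK (cheb_poly K (m + n)) <= normK (cheb_poly K m) * normK (cheb_poly K n).
Proof.
have [mm sm _] := cheb_polyP m; have [mn sn _] := cheb_polyP n.
have [_ _ mmn] := cheb_polyP (m + n).
apply: le_trans (supnorm_hornerM _ _); apply: mmn; first by rewrite monicMl.
rewrite size_proper_mul ?(monicP mm) ?(monicP mn) ?mul1r ?oner_neq0//.
by rewrite sm sn addSn addnS.
Qed.

(** [cap K] is a value of [limn], so the hypothesis [cap K < 1] says something
    about the Chebyshev norms only because the limit exists. *)
Lemma cap_lt1_geometric : cap K < 1 -> exists r N, [/\ 0 <= r, r < 1 &
  forall n, (N <= n)%N -> [/\ cheb_poly K n \is monic,
    size (cheb_poly K n) = n.+1 &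
    forall x, K x -> `|(cheb_poly K n).[x]| <= r ^+ n]].
Proof.
move=> cap1.
have cu := submultiplicative_root_cvg
  (fun n => supnorm_horner_ge0 (cheb_poly K n)) cheb_norm_submultiplicative.
have cap0 : 0 <= cap K.
  by apply: limr_ge => //; apply: nearW => n; exact: powR_ge0.
pose r := (cap K + 1) / 2.
have r1 : r < 1 by rewrite /r; lra.
have r0 : 0 <= r by rewrite /r; lra.
have capr : cap K < r by rewrite /r; lra.
have [N _ HN] := cvgr_lt _ cu _ capr.
exists r, (maxn N 1); split => // n; rewrite geq_max => /andP[Nn n0].
have [mn sn _] := cheb_polyP n; split => // x Kx.
apply: le_trans (supnorm_horner_ub _ Kx) _.
by rewrite -rootn_le ?supnorm_horner_ge0// ltW//; exact: HN.
Qed.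

End Chebyshev.

(** * Minimal polynomials *)

Section MinimalPolynomial.
Variable R : realType.
Implicit Types (a x : R) (P : {poly int}).

Lemma map_ratr_intr (F : numFieldType) P :
  map_poly (ratr : rat -> F) (map_poly intr P) = map_poly intr P.
Proof.
by rewrite -map_poly_comp; apply: eq_map_poly => i /=; rewrite ratr_int.
Qed.

Lemma exists_minpoly a P : P != 0 -> zeval P a = 0 -> exists p, is_minpoly a p.
Proof.
move=> P0 Pa.
pose annihilates n := `[< exists q : {poly rat},
  [/\ q != 0, root (map_poly (ratr : rat -> R) q) a & size q = n] >].
have exA : exists n, annihilates n.
  exists (size (map_poly intr P : {poly rat})); apply/asboolP.
  exists (map_poly intr P); split => //.
    by rewrite map_poly_eq0_id0// intr_eq0 lead_coef_eq0.
  by rewrite map_ratr_intr rootE; apply/eqP.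
case: (ex_minnP exA) => n /asboolP[q [q0 qa sq]] nmin.
have lq0 : lead_coef q != 0 by rewrite lead_coef_eq0.
exists ((lead_coef q)^-1 *: q); split.
  by rewrite monicE lead_coefZ mulVf.
move=> h; rewrite dvdpZl ?invr_eq0//; apply/idP/idP => [ha|/dvdpP[k ->]]; last first.
  by rewrite rmorphM rootM qa orbT.
rewrite dvdpE; apply: contraT => r0; rewrite -dvdpE in r0.
have : annihilates (size (h %% q)).
  apply/asboolP; exists (h %% q); split => //.
  have -> : h %% q = h - h %/ q * q by rewrite {2}(divp_eq h q) addrC addKr.
  rewrite rootE rmorphB rmorphM !hornerE.
  by rewrite (eqP ha) (eqP qa) mulr0 subrr.
by move/nmin; rewrite leqNgt -sq ltn_modp q0.
Qed.

(** The multiples of the monic polynomial [\prod_(z <- s) ('X - z)] vanish on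
    [s]; by the pigeonhole principle, one of them is close to an integer
    polynomial, which is not zero because the multiple has an integer leading
    coefficient at least [1]. *)
Lemma integer_poly_small_at (s : seq R) n (e : R) : (size s < n)%N -> 0 < e ->
  exists2 I : {poly int}, I != 0 & (size I <= n)%N /\
    forall x, x \in s -> `|zeval I x| <= e.
Proof.
move=> sn e0; pose v : {poly R} := \prod_(z <- s) ('X - z%:P).
pose B := 1 + \sum_(z <- s) `|z|.
have B1 : 1 <= B by rewrite lerDl sumr_ge0.
have sB x : x \in s -> `|x| <= B.
  by move=> xs; rewrite /B (big_rem x)//= addrCA lerDl addr_ge0// sumr_ge0.
(* [1 < D] is used to recognize that [I] is not zero. *)
pose D := (Num.truncn (n%:R * B ^+ n / e)).+2.
have sv : size v = (size s).+1 by exact: size_prod_XsubC.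
have sA t : (size (t%:R *: v) <= n)%N.
  by rewrite (leq_trans (size_scale_leq _ _))// sv.
have [t1 [t2 [I [t12 sI IA]]]] :=
  @pigeonhole_frac R (fun t => t%:R *: v) n D isT sA.
exists I.
  apply/eqP => I0; have := IA (size s).
  have v1 : v`_(size s) = 1.
    have /monicP : v \is monic by exact: monic_prod_XsubC.
    by rewrite lead_coefE sv.
  rewrite I0 rmorph0 subr0 coefB !coefZ v1 !mulr1 -natrB ?(ltnW t12)//.
  rewrite ger0_norm// => h.
  have : 1 <= D%:R^-1 :> R by apply: le_trans h; rewrite ler1n subn_gt0.
  by rewrite invf_ge1 ?ltr0n// lern1.
split=> // x xs.
have vx : v.[x] = 0 by apply/eqP; rewrite -/(root v x) root_prod_XsubC.
have sAI : (size (t2%:R *: v - t1%:R *: v - map_poly intr I)%R <= n)%N.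
  rewrite (leq_trans (size_polyD _ _))// size_polyN geq_max.
  rewrite size_map_inj_poly ?sI ?andbT//; last exact: intr_inj.
  by rewrite (leq_trans (size_polyD _ _))// size_polyN geq_max !sA.
have := ler_norm_horner sAI B1 (sB x xs) IA.
rewrite !(hornerD, hornerN, hornerZ) vx !mulr0 subrr sub0r normrN => /le_trans; apply.
rewrite mulrCA [leLHS]mulrC ler_pdivrMr ?ltr0n// [leRHS]mulrC -ler_pdivrMr//.
by rewrite (le_trans (ltW (truncnS_gt _)))// ler_nat.
Qed.

End MinimalPolynomial.

(** * The zeros common to all small integer polynomials *)

Section Kernel.
Variable R : realType.
Variable K : set R.
Hypotheses (cK : compact K) (K0 : K !=set0).
Implicit Types (P Q : {poly int}).

(** Truncating the values of [Q] to the interval from [- 1 / 2] to [1 / 2]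
    does not change them at the zeros of [P] in [K]; the difference is thus a
    limit of integer multiples of [P]. *)
Lemma BZ_congruent P Q : BZ K P -> P != 0 ->
  (forall x, K x -> zeval P x = 0 -> `|zeval Q x| <= 2^-1) ->
  exists G, BZ K (Q + P * G).
Proof.
move=> BP P0 Qs.
pose h : R -> R := (cst (- 2^-1)) \max (cst (2^-1) \min zeval Q).
have ch : continuous h.
  move=> x; apply: continuous_max; first exact: cvg_cst.
  by apply: continuous_min; [exact: cvg_cst|exact: continuous_zeval].
have cf : continuous (fun x => h x - zeval Q x).
  by move=> x; apply: cvgB; [exact: ch|exact: continuous_zeval].
have hle x : `|h x| <= 2^-1.
  rewrite /h /= ler_norml le_max lexx/= ge_max ge_min lexx andbT.
  by lra.
have f0 x : K x -> zeval P x = 0 -> h x - zeval Q x = 0.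
  move=> Kx Px; have := Qs x Kx Px; rewrite ler_norml => /andP[q1 q2].
  by rewrite /h /= min_r// max_r// subrr.
have e0 : 0 < 4^-1 :> R by rewrite invr_gt0.
have [G PG] := approx_integer_multiples cK K0 BP P0 cf f0 e0.
exists G; apply/(BZP _ cK K0); exists (3 / 4); first lra.
move=> x Kx; have := PG x Kx; have := hle x; rewrite zevalD !ler_norml.
by move=> /andP[? ?] /andP[? ?]; apply/andP; split; lra.
Qed.

(** If some conjugate of [a] is not in [K], the minimal polynomial [p] of [a]
    has fewer roots in [K] than its degree, so that some integer polynomial
    [I] of degree less than that of [p] is small at these roots; it is not
    zero at [a]. Multiplied by the part [q] of [P] prime to [p], it is small
    at all zeros of [P] in [K], and [BZ_congruent] contradicts the choice of
    [a] in [J K]. *)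
Lemma J_subset_J0 P : BZ K P -> P != 0 -> J K `<=` J0 K.
Proof.
move=> BP P0 a Ja; split => //.
have [Ka aB] := Ja; have Pa := aB P BP.
have [p pmin] := exists_minpoly P0 Pa; exists p => //.
have [pm pdvd] := pmin; have p0 : p != 0 by exact: monic_neq0.
apply: contrapT => /existsNP[z /not_implyP[pz zK]].
pose pC := map_poly (ratr : rat -> R[i]) p.
pose pR := map_poly (ratr : rat -> R) p.
have pCR : pC = map_poly (real_complex R) pR.
  rewrite /pC /pR -map_poly_comp; apply: eq_map_poly => q /=.
  by rewrite fmorph_div !rmorph_int.
have [r pr] := closed_field_poly_normal pC.
have lpC : lead_coef pC = 1 by rewrite lead_coef_map (monicP pm) rmorph1.
rewrite lpC scale1r in pr.
have zr : z \in r by rewrite -root_prod_XsubC -pr.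
have sr : size p = (size r).+1.
  rewrite -(size_map_poly (ratr : {rmorphism rat -> R[i]})) -/pC pr.
  exact: size_prod_XsubC.
pose inK (w : R[i]) := `[< exists2 x : R, K x & w = x%:C%C >].
pose s := [seq complex.Re w | w <- r & inK w].
have ss : (size s < size r)%N.
  rewrite size_map size_filter ltn_neqAle count_size andbT -all_count.
  by apply/allPn; exists z => //; apply/negP => /asboolP.
have ps x : K x -> root pR x -> x \in s.
  move=> Kx px; apply/mapP; exists x%:C%C => //; rewrite mem_filter.
  apply/andP; split; first by apply/asboolP; exists x.
  by rewrite -root_prod_XsubC -pr pCR fmorph_root.
pose PQ : {poly rat} := map_poly intr P.
have [q [c c0 qc]] := rat_poly_scale (gdcop p PQ).
have qE x : zeval q x = c%:~R * (gdcop pR (map_poly intr P)).[x].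
  have <- : map_poly ratr (gdcop p PQ) = gdcop pR (map_poly intr P) :> {poly R}.
    by rewrite gdcop_map map_ratr_intr.
  rewrite qc linearZ/= hornerZ map_ratr_intr fmorphV/= ratr_int.
  by rewrite mulrA divff ?mul1r// intr_eq0.
have PR0 : map_poly intr P != 0 :> {poly R}.
  by rewrite map_poly_eq0_id0// intr_eq0 lead_coef_eq0.
have q0 x : (zeval q x == 0) = (zeval P x == 0) && (pR.[x] != 0).
  by rewrite qE mulf_eq0 intr_eq0 (negbTE c0)/=; exact: root_gdco.
have [M M0 qM] := compact_ler_norm cK (@continuous_zeval R q).
have e0 : 0 < (2 * M)^-1 by rewrite invr_gt0 mulr_gt0.
have [I I0 [sI Is]] := integer_poly_small_at ss e0.
have pa : pR.[a] = 0 by apply/eqP; rewrite -/(root pR a) pdvd.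
have Ia : zeval I a != 0.
  apply/negP => Ia; have : root (map_poly ratr (map_poly intr I)) a.
    by rewrite map_ratr_intr.
  rewrite pdvd => /dvdp_leq.
  rewrite map_poly_eq0_id0 ?intr_eq0 ?lead_coef_eq0// => /(_ I0).
  by rewrite size_map_inj_poly ?sr ?ltnNge ?sI//; exact: intr_inj.
have [G BG] : exists G, BZ K (I * q + P * G).
  apply: BZ_congruent => // x Kx Px; rewrite zevalM normrM.
  have [px|px] := eqVneq pR.[x] 0; last first.
    have /eqP -> : zeval q x == 0 by rewrite q0 Px eqxx.
    by rewrite normr0 mulr0 invr_ge0.
  have -> : 2^-1 = (2 * M)^-1 * M by field; rewrite gt_eqF.
  by rewrite ler_pM// ?qM// Is// ps//; apply/eqP.
have := aB _ BG; rewrite zevalD !zevalM Pa mul0r addr0 => /eqP.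
by rewrite mulf_eq0 (negbTE Ia)/= q0 pa eqxx andbF.
Qed.

Lemma BZ_sum_even_powers P Q : BZ K P -> BZ K Q ->
  exists n, BZ K (P ^+ (n.+1).*2 + Q ^+ (n.+1).*2).
Proof.
move=> /(BZP _ cK K0)[r1 r11 Pr] /(BZP _ cK K0)[r2 r21 Qr].
have [y Ky] := K0.
pose r := Num.max r1 r2.
have r0 : 0 <= r by rewrite le_max (le_trans _ (Pr y Ky)).
have r_1 : r < 1 by rewrite gt_max r11.
have e0 : 0 < 4^-1 :> R by rewrite invr_gt0.
have [N HN] := expr_small r0 r_1 e0.
exists N; apply/(BZP _ cK K0); exists 2^-1; first lra.
have bound S x : `|zeval S x| <= r -> `|zeval S x ^+ (N.+1).*2| <= 4^-1.
  move=> Sr; rewrite normrX (le_trans _ (HN (N.+1).*2 _))//; last by lia.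
  by rewrite lerXn2r ?nnegrE.
move=> x Kx; rewrite zevalD !zevalX (le_trans (ler_normD _ _))//.
have h1 := bound P x _; have h2 := bound Q x _.
have : `|zeval P x| <= r by rewrite le_max Pr.
have : `|zeval Q x| <= r by rewrite le_max Qr// orbT.
by move=> /h2 ? /h1 ?; lra.
Qed.

(** The real zeros of a sum of two even powers are the common zeros. A zero of
    [P] in [K] outside [J K] is not a zero of some element of [BZ K]; as the
    real zeros of [P] are finitely many, they are removed one at a time. *)
Lemma exists_BZ_zeros_in_J P : BZ K P -> P != 0 ->
  exists Q, [/\ BZ K Q, Q != 0 & forall x, K x -> zeval Q x = 0 -> J K x].
Proof.
move=> BP P0.
suff H (s : seq R) : exists Q, [/\ BZ K Q, Q != 0,
    forall x : R, zeval Q x = 0 -> zeval P x = 0 &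
    forall x, x \in s -> K x -> zeval Q x = 0 -> J K x].
  have PR0 : map_poly intr P != 0 :> {poly R}.
    by rewrite map_poly_eq0_id0// intr_eq0 lead_coef_eq0.
  have [Q [BQ Q0 QP QJ]] := H (rootsR (map_poly intr P : {poly R})).
  exists Q; split => // x Kx Qx; apply: QJ => //.
  by rewrite -(roots_on_rootsR PR0) in_itv/= rootE; apply/eqP/QP.
elim: s => [|y s [Q [BQ Q0 QP QJ]]]; first by exists P; split.
have [[Ky NJy]|yJ] := pselect (K y /\ ~ J K y); last first.
  exists Q; split => // x; rewrite inE => /predU1P[->|]; last exact: QJ.
  by move=> Ky _; apply: contrapT => NJy; apply: yJ.
have [S BS Sy] : exists2 S, BZ K S & zeval S y != 0.
  apply: contrapT => NS; apply: NJy; split => // S BS; apply/eqP.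
  by apply: contrapT => /negP Sy; apply: NS; exists S.
have [n BT] := BZ_sum_even_powers BQ BS.
have T0 (x : R) : zeval (Q ^+ (n.+1).*2 + S ^+ (n.+1).*2) x = 0 ->
    zeval Q x = 0 /\ zeval S x = 0.
  rewrite zevalD !zevalX => /eqP; rewrite paddr_eq0 ?exprn_even_ge0 ?odd_double//.
  by rewrite !expf_eq0/= => /andP[/eqP ? /eqP ?].
exists (Q ^+ (n.+1).*2 + S ^+ (n.+1).*2); split => //.
- apply: contra_neq Sy => T00; apply: (T0 y _).2.
  by rewrite T00 /zeval rmorph0 horner0.
- by move=> x /T0[/QP].
move=> x; rewrite inE => /predU1P[->|xs] Kx /T0[Qx Sx]; last exact: QJ.
by rewrite Sx eqxx in Sy.
Qed.

End Kernel.

(** * The approximation theorem *)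

Section Uniform.
Variable R : realType.

Lemma Z_approximableP (K : set R) (f : R -> R) : Z_approximable K f <->
  forall e : R, 0 < e -> exists P : {poly int},
    forall x, K x -> `|f x - zeval P x| <= e.
Proof.
split=> [[P Pf] e e0|H].
  have : nbhs (f : {uniform` K -> R})
      [set h | forall y, K y -> ball (f y) e (h y)].
    apply/uniform_nbhs; exists [set xy | ball xy.1 e xy.2]; split => //.
    exact: (entourage_ball _ (PosNum e0)).
  move=> /Pf[N _ HN]; exists (P N) => x Kx; apply/ltW.
  by have := HN N (leqnn _) x Kx; rewrite /ball /=.
have n0 n : 0 < n.+1%:R^-1 :> R by rewrite invr_gt0.
have /choice[P HP] n := H _ (n0 n).
exists P => A /uniform_nbhs[E [entE EA]].
have [e e0 eE] : exists2 e : R, 0 < e & [set xy | ball xy.1 e xy.2] `<=` E.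
  by move: entE; rewrite -entourage_ballE => -[e /= e0 eE]; exists e.
have [N _ HN] := near_infty_natSinv_lt (PosNum e0).
exists N => // n /= /HN/= Nn; apply: EA => y Ky; apply: eE => /=.
by rewrite /ball /=; apply: le_lt_trans Nn; exact: HP.
Qed.

End Uniform.

Theorem proposition5p2 (R : realType) (K : set R) (cK : compact K)
    (infK : infinite_set K) (capK : cap K < 1)
    (f : R -> R) (cf : {within K, continuous f}) :
  Z_approximable K f <-> Z_interpolable (J0 K) f.
Proof.
have K0 : K !=set0 by exact: infinite_setN0.
rewrite Z_approximableP; split=> [H|[Q fQ] e e0].
  have q0 : 0 < 4^-1 :> R by rewrite invr_gt0.
  have [P HP] := H _ q0.
  exists P => x [[Kx Bx] _].
  apply/eqP; rewrite -subr_eq0 -normr_le0; apply/ler_addgt0Pl => e e0.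
  (* Two approximants at distance at most [1 / 4] from [f] agree at [x]. *)
  have e40 : 0 < Num.min e 4^-1 by rewrite lt_min e0 invr_gt0 ltr0n.
  have [Q HQ] := H _ e40.
  have BPQ : BZ K (P - Q).
    apply/(BZP _ cK K0); exists 2^-1; first lra.
    move=> y Ky; have := HP y Ky; have := HQ y Ky.
    rewrite zevalB le_min => /andP[_]; rewrite !ler_norml.
    by move=> /andP[? ?] /andP[? ?]; apply/andP; split; lra.
  have := Bx _ BPQ; rewrite zevalB => /subr0_eq ->.
  by have := HQ x Kx; rewrite le_min addr0 => /andP[].
have [r [N [r0 r1 bP]]] := cap_lt1_geometric cK infK capK.
have [B B0 KB] := @compact_ler_norm _ K id cK (fun x => cvg_id).
have B1 : 1 <= B + 1 by lra.
have KB1 x : K x -> `|x| <= B + 1 by move=> /KB /= ?; lra.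
have [P P0 /(BZP _ cK K0) BP] := small_integer_poly B1 KB1 r0 r1 bP.
have [S [BS S0 SJ]] := exists_BZ_zeros_in_J cK K0 BP P0.
(* Tietze's theorem replaces [f] by a function continuous on the whole line. *)
have [g [fg cg _]] : exists g : R -> R^o,
    [/\ {in K, f =1 g}, continuous g & True].
  have : compact (f @` K) by exact: continuous_compact.
  move=> /compact_bounded/ex_strict_bound_gt0[M M0 HM].
  have fM x : K x -> `|f x| <= M by move=> Kx; apply/ltW/HM; exists x.
  have clK := compact_closed (@Rhausdorff R) cK.
  have [g [fg cg _]] :=
    continuous_bounded_extension pseudometric_normal clK M0 cf fM.
  by exists g.
have cgQ : continuous (fun x => g x - zeval Q x).
  by move=> x; apply: cvgB; [exact: cg|exact: continuous_zeval].
have gQ0 x : K x -> zeval S x = 0 -> g x - zeval Q x = 0.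
  move=> Kx Sx; rewrite -fg ?inE// fQ ?subrr//.
  exact: J_subset_J0 BS S0 _ (SJ _ Kx Sx).
have [G HG] := approx_integer_multiples cK K0 BS S0 cgQ gQ0 e0.
exists (Q + S * G) => x Kx; rewrite zevalD opprD addrA fg ?inE//.
exact: HG.
Qed.
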